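(* Let $m>2$ be an integer and let $F(2,m)$ be the Fibonacci group \[ F(2,m)=\langle a_1,a_2,\dots,a_m \mid a_i a_{i+1}=a_{i+2}\ (1\le i\le m,\ \text{indices modulo } m)\rangle . \] Then each generator $a_i$ ($1\le i\le m$) is a generalized torsion element of $F(2,m)$.
   Context: A generalized torsion element of a group $G$ is a non-trivial element $g\in G$ such that some non-empty finite product of conjugates of $g$ equals the identity, i.e. there are $k\ge 1$ and $x_1,\dots,x_k\in G$ with $(x_1^{-1}gx_1)(x_2^{-1}gx_2)\cdots(x_k^{-1}gx_k)=1$. *)

(* Defs.v *)
From HB Require Import structures.
From mathcomp Require Import all_boot.
From mathcomp Require Import boolp.

Set Implicit Arguments.
Unset Strict Implicit.
Unset Printing Implicit Defensive.

Local Open Scope group_scope.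

Definition generalized_torsion (G : groupType) (g : G) : Prop :=
  g <> 1 /\
  exists (k : nat) (x : 'I_k -> G),
    (0 < k)%N /\ \big[*%g/1]_(i < k) (g ^ x i) = 1.

(* Words over the alphabet X and its formal inverses: the letter (x, false)
   stands for x and (x, true) for its inverse. *)
Definition word (X : Type) : Type := seq (X * bool).

Definition winv (X : Type) (u : word X) : word X :=
  rev [seq (l.1, ~~ l.2) | l <- u].

Definition wval (X : Type) (G : groupType) (f : X -> G) (u : word X) : G :=
  \big[*%g/1]_(l <- u) (if l.2 then (f l.1)^-1 else f l.1).

(* The least congruence on words that cancels adjacent inverse letters and
   identifies u with v for every defining relation R u v. *)
Inductive pres_cong (X : Type) (R : word X -> word X -> Prop) :
    word X -> word X -> Prop :=
| PresRefl u : pres_cong R u u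
| PresSym u v : pres_cong R u v -> pres_cong R v u
| PresTrans u v w : pres_cong R u v -> pres_cong R v w -> pres_cong R u w
| PresCat u u' v v' :
    pres_cong R u u' -> pres_cong R v v' -> pres_cong R (u ++ v) (u' ++ v')
| PresCancel x b : pres_cong R [:: (x, b); (x, ~~ b)] [::]
| PresRel u v : R u v -> pres_cong R u v.

Section PresentedGroup.

Variables (X : choiceType) (R : word X -> word X -> Prop).

Definition pres_congb (u v : word X) : bool := `[< pres_cong R u v >].

Fact pres_congb_refl : reflexive pres_congb.
Proof. by move=> u; apply/asboolP; exact: PresRefl. Qed.

Fact pres_congb_sym : symmetric pres_congb.
Proof. by move=> u v; apply/asboolP/asboolP; exact: PresSym. Qed.

Fact pres_congb_trans : transitive pres_congb.
Proof.
by move=> v u w /asboolP uv /asboolP vw; apply/asboolP; exact: PresTrans vw.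
Qed.

Canonical pres_congb_equiv :=
  EquivRel pres_congb pres_congb_refl pres_congb_sym pres_congb_trans.

Local Open Scope quotient_scope.

(* The group < X | u = v for all u, v such that R u v >. *)
Definition presented : Type := {eq_quot pres_congb}.

HB.instance Definition _ := Choice.on presented.
HB.instance Definition _ := EqQuotient.on presented.

Lemma presP (u v : word X) :
  \pi_presented u = \pi_presented v <-> pres_cong R u v.
Proof. by split=> [/eqmodP/asboolP|uv]; last by apply/eqmodP/asboolP. Qed.

Lemma presW (P : presented -> Prop) :
  (forall u : word X, P (\pi_presented u)) -> forall a, P a.
Proof. by move=> Ppi a; rewrite -[a]reprK. Qed.

Lemma pres_repr (u : word X) : pres_cong R (repr (\pi_presented u)) u.
Proof. by apply/presP; rewrite reprK. Qed.

Lemma winv_cat (u v : word X) : winv (u ++ v) = winv v ++ winv u.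
Proof. by rewrite /winv map_cat rev_cat. Qed.

Lemma pres_cong_winvl (u : word X) : pres_cong R (winv u ++ u) [::].
Proof.
elim: u => [|[x b] u IH]; first exact: PresRefl.
rewrite -[(x, b) :: u]cat1s winv_cat -catA.
apply: PresTrans IH; apply: PresCat; first exact: PresRefl.
rewrite catA; apply: (@PresCat _ _ _ [::] u u); last exact: PresRefl.
by have := PresCancel R x (~~ b); rewrite negbK.
Qed.

Lemma pres_cong_winvr (u : word X) : pres_cong R (u ++ winv u) [::].
Proof.
elim: u => [|[x b] u IH]; first exact: PresRefl.
rewrite -[(x, b) :: u]cat1s winv_cat -catA.
apply: PresTrans (PresCancel R x b).
apply: (PresCat (PresRefl R [:: (x, b)])).
by rewrite catA; apply: (PresCat IH); exact: PresRefl.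
Qed.

Lemma pres_cong_inv (u v : word X) :
  pres_cong R u v -> pres_cong R (winv u) (winv v).
Proof.
move=> uv; apply: (@PresTrans _ _ _ (winv u ++ (v ++ winv v))).
  rewrite -{1}[winv u]cats0; apply: (PresCat (PresRefl R _)).
  exact/PresSym/pres_cong_winvr.
rewrite catA; apply: (@PresCat _ _ _ [::]); last exact: PresRefl.
apply: PresTrans (pres_cong_winvl u); apply: (PresCat (PresRefl R _)).
exact: PresSym.
Qed.

Definition pres_mul (a b : presented) : presented :=
  \pi_presented (repr a ++ repr b).
Definition pres_one : presented := \pi_presented [::].
Definition pres_inv (a : presented) : presented :=
  \pi_presented (winv (repr a)).

Lemma pres_mulE (u v : word X) :
  pres_mul (\pi_presented u) (\pi_presented v) = \pi_presented (u ++ v).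
Proof. by apply/presP; apply: PresCat; exact: pres_repr. Qed.

Lemma pres_invE (u : word X) :
  pres_inv (\pi_presented u) = \pi_presented (winv u).
Proof. by apply/presP; apply: pres_cong_inv; exact: pres_repr. Qed.

Fact pres_mulA : associative pres_mul.
Proof.
move=> a b c; elim/presW: a => u; elim/presW: b => v; elim/presW: c => w.
by rewrite (pres_mulE v w) (pres_mulE u v) !pres_mulE catA.
Qed.

Fact pres_mul1 : left_id pres_one pres_mul.
Proof. by elim/presW=> u; exact: (pres_mulE [::] u). Qed.

Fact pres_mulr1 : right_id pres_one pres_mul.
Proof. by elim/presW=> u; rewrite (pres_mulE u [::]) cats0. Qed.

Fact pres_mulV : left_inverse pres_one pres_inv pres_mul.
Proof.
elim/presW=> u; rewrite (pres_invE u) (pres_mulE (winv u) u).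
by apply/presP; exact: pres_cong_winvl.
Qed.

Fact pres_mulrV : right_inverse pres_one pres_inv pres_mul.
Proof.
elim/presW=> u; rewrite (pres_invE u) (pres_mulE u (winv u)).
by apply/presP; exact: pres_cong_winvr.
Qed.

HB.instance Definition _ := isGroup.Build presented
  pres_mulA pres_mul1 pres_mulr1 pres_mulV pres_mulrV.

Definition pres_gen (x : X) : presented := \pi_presented [:: (x, false)].

Lemma pres_gen_wval (u : word X) : wval pres_gen u = \pi_presented u.
Proof.
rewrite /wval; elim: u => [|[x b] u IH]; first by rewrite big_nil.
rewrite big_cons IH -cat1s -[RHS](pres_mulE [:: (x, b)] u); congr (_ * _).
by case: b => //=; exact: (pres_invE [:: (x, false)]).
Qed.

Lemma pres_rel (u v : word X) : R u v -> wval pres_gen u = wval pres_gen v.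
Proof. by move=> Ruv; rewrite !pres_gen_wval; apply/presP; exact: PresRel. Qed.

Lemma pres_univ (G : groupType) (f : X -> G) :
  (forall u v, R u v -> wval f u = wval f v) ->
  exists phi : presented -> G,
    {morph phi : a b / a * b} /\ forall x, phi (pres_gen x) = f x.
Proof.
move=> fR.
have fcong u v : pres_cong R u v -> wval f u = wval f v.
  elim=> {u v} [//|//|u v w _ -> //|u u' v v' _ uu' _ vv'|x b|//].
    by rewrite /wval !big_cat; congr (_ * _).
  by rewrite /wval !big_cons !big_nil /=; case: b;
     rewrite /= mulg1 ?mulgV ?mulVg.
exists (fun a => wval f (repr a)); split.
  move=> a b; have /fcong -> := pres_repr (repr a ++ repr b).
  by rewrite /wval big_cat.
move=> x; have /fcong -> := pres_repr [:: (x, false)].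
by rewrite /wval big_cons big_nil mulg1.
Qed.

End PresentedGroup.

(* The index set Z/m is encoded as 'I_m with its cyclic successor ordS, so
   that 0, ..., m-1 stand for the indices 1, ..., m. *)
Definition fib_rel (m : nat) (u v : word 'I_m) : Prop :=
  exists i : 'I_m,
    u = [:: (i, false); (ordS i, false)] /\ v = [:: (ordS (ordS i), false)].

Definition fib_group (m : nat) : groupType := presented (@fib_rel m).

Definition fib_gen (m : nat) (i : 'I_m) : fib_group m :=
  pres_gen (@fib_rel m) i.

(* Main.v *)
Require Import Defs.
From HB Require Import structures.
From mathcomp Require Import all_boot.
From mathcomp Require Import all_fingroup all_algebra.
From mathcomp Require Import ring zify.

(** Write x = a_i and let b_0 = x, b_1 = y, b_2, ... be the generators read
    cyclically from a_i on, so that b_k b_{k+1} = b_{k+2} and b has period m.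

    To see that x is killed by a product of its conjugates, let S be the
    semigroup generated by the conjugates of x.  As S is closed under
    conjugation, S z^p S z^q is contained in S z^{p+q} for every z.  Running the
    recursion forwards, each b_k with k >= 2 is a positive word in x and y, hence
    lies in the union of the S y^p with p >= 1; and y = b_{m+1} is a product of
    two such elements, so y is in S y^p with p >= 2, that is, some positive power
    of y^-1 lies in S.  Running the recursion backwards from b_{2m} = x and
    b_{2m+1} = y, the elements b_{2j} and b_{2j+1}^-1 with j < m are positive
    words in x and y^-1; starting from an even index 2m makes the parities such
    that y^-1 = b_1^-1 appears among them, whatever the parity of m.  So y^-1
    lies in S (y^-1)^p with p >= 2, and some positive power of y lies in S.
    Multiplying suitable powers of these two elements of S shows that 1 is in S.

    To see that x is not 1, the abelianization suffices: a homomorphism to an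
    abelian group is a sequence w of period m with w_k + w_{k+1} = w_{k+2}.  With
    F the Fibonacci sequence, w_0 = F_m and w_1 = 1 - F_{m-1} generate such a
    sequence modulo N = L_m - 1 - (-1)^m, where L_m is the Lucas number
    F_{m-1} + F_{m+1}: by Cassini's identity w_m = w_0 already in the integers
    and w_{m+1} - w_1 = N.  For m > 2 one has 0 < F_m < N, so w_0 is nonzero
    modulo N. *)

Set Implicit Arguments.
Unset Strict Implicit.
Unset Printing Implicit Defensive.

Local Open Scope group_scope.

(** * Semigroups generated by a conjugacy class *)

Section ConjSemigroup.

Variables (G : groupType) (x : G).

Inductive conj_semigroup : G -> Prop :=
| ConjSemigroupGen c : conj_semigroup (x ^ c)
| ConjSemigroupMul g h :
    conj_semigroup g -> conj_semigroup h -> conj_semigroup (g * h).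

Lemma conj_semigroupJ g c : conj_semigroup g -> conj_semigroup (g ^ c).
Proof.
elim=> [d|g1 g2 _ Sg1 _ Sg2]; first by rewrite -conjgM; left.
by rewrite conjMg; right.
Qed.

Lemma conj_semigroupX g n : conj_semigroup g -> conj_semigroup (g ^+ n.+1).
Proof.
move=> Sg; elim: n => [|n IHn]; first by rewrite expg1.
by rewrite expgS; right.
Qed.

Lemma conj_semigroup_prod g : conj_semigroup g ->
  exists k (c : 'I_k -> G), (0 < k)%N /\ \prod_(i < k) x ^ c i = g.
Proof.
move=> Sg; have [s [s_gt0 <-]] :
    exists s : seq G, (0 < size s)%N /\ \prod_(c <- s) x ^ c = g.
  elim: Sg => [c|_ _ _ [s1 [s1_gt0 <-]] _ [s2 [_ <-]]].
    by exists [:: c]; rewrite big_seq1.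
  by exists (s1 ++ s2); rewrite size_cat addn_gt0 s1_gt0 big_cat.
by exists (size s), (tnth (in_tuple s)); rewrite [RHS]big_tnth.
Qed.

(** A word in x and z without negative exponents in which both letters occur
    has this form: the powers of z move to the right past the conjugates of x,
    which turn into other conjugates of x. *)
Definition positive_word (z g : G) : Prop :=
  exists s n, conj_semigroup s /\ g = s * z ^+ n.+1.

Lemma positive_word_lmul z s g :
  conj_semigroup s -> positive_word z g -> positive_word z (s * g).
Proof.
move=> Ss [t [n [St ->]]]; exists (s * t), n; rewrite mulgA.
by split=> //; right.
Qed.

Lemma positive_word_mul_excess z g h :
  positive_word z g -> positive_word z h ->
  exists s n, conj_semigroup s /\ g * h = s * z ^+ n.+2.
Proof.
move=> [s [n [Ss ->]]] [t [k [St ->]]].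
exists (s * t ^ (z ^- n.+1)), (n + k)%N; split.
  by right=> //; exact: conj_semigroupJ.
rewrite -(addSn n) -addnS expgnDr /conjg invgK !mulgA.
by rewrite mulgKV.
Qed.

Lemma positive_word_mul z g h :
  positive_word z g -> positive_word z h -> positive_word z (g * h).
Proof.
move=> Pg Ph; have [s [n [Ss ->]]] := positive_word_mul_excess Pg Ph.
by exists s, n.+1.
Qed.

(** If z = s z^p with s in the semigroup and p > 1, cancelling one z gives
    z^-(p-1) = s. *)
Lemma positive_word_mul_self z g h :
  positive_word z g -> positive_word z h -> g * h = z ->
  exists n, conj_semigroup (z ^- n.+1).
Proof.
move=> Pg Ph; have [s [n [Ss ->]]] := positive_word_mul_excess Pg Ph.
rewrite expgSr mulgA => /(canRL (mulgK z)); rewrite mulgV => szn.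
by exists n; rewrite -[_ ^- _]mul1g -szn mulgK.
Qed.

Lemma conj_semigroup1_opposite z n k :
  conj_semigroup (z ^+ n.+1) -> conj_semigroup (z ^- k.+1) ->
  conj_semigroup 1.
Proof.
move=> /(conj_semigroupX k) Szn /(conj_semigroupX n) Szk.
have -> : 1 = (z ^+ n.+1) ^+ k.+1 * (z ^- k.+1) ^+ n.+1 :> G.
  by rewrite expgVn -!expgM mulnC mulgV.
by right.
Qed.

End ConjSemigroup.

(** * Periodic sequences satisfying the Fibonacci recursion in a group *)

Section PeriodicSequence.

Variables (G : groupType) (b : nat -> G) (m : nat).
Hypothesis b_rec : forall k, b k * b k.+1 = b k.+2.
Hypothesis b_per : forall k, b (m + k)%N = b k.
Hypothesis m_gt2 : (2 < m)%N.

Let x_in : conj_semigroup (b 0) (b 0).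
Proof. by rewrite -{2}[b 0]conjg1; left. Qed.

Let x_mul_positive z : positive_word (b 0) z (b 0 * z).
Proof. by exists (b 0), 0; rewrite expg1. Qed.

Lemma forward_positive k : positive_word (b 0) (b 1) (b k.+2).
Proof.
suff [] : positive_word (b 0) (b 1) (b k.+2) /\
          positive_word (b 0) (b 1) (b k.+3) by [].
elim: k => [|k [IHk IHk1]].
  rewrite -(b_rec 1%N) -(b_rec 0); split=> //.
  (* y x y = x^(y^-1) y^2 *)
  exists (b 0 ^ (b 1)^-1), 1%N; split; first by left.
  by rewrite (expgS _ 1) expg1 /conjg invgK !mulgA mulgKV.
by split=> //; rewrite -(b_rec k.+2); exact: positive_word_mul.
Qed.

Let b_rec_back k : b k.+2 * (b k.+1)^-1 = b k.
Proof. by rewrite -b_rec mulgK. Qed.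

Let b_rec_backV k : b k.+1 * (b k.+2)^-1 = (b k)^-1.
Proof. by rewrite -b_rec invgM mulVKg. Qed.

(** Solving the recursion for its first term makes the signs alternate: from
    b_{2m} = x and b_{2m+1}^-1 = y^-1 each step down multiplies an element of even
    index by the inverse of one of odd index.  The induction starts one step
    below, as x itself involves no power of y^-1. *)
Lemma backward_positive j k : (j + k.*2.+2 = m.*2)%N ->
  positive_word (b 0) (b 1)^-1 (b j) /\
  positive_word (b 0) (b 1)^-1 (b j.+1)^-1.
Proof.
elim: k j => [|k IHk] j jk.
  have bj2 : b j.+2 = b 0.
    by rewrite -addn2 jk -addnn b_per -[in LHS](addn0 m) b_per.
  have bj3 : b j.+3 = b 1.
    by rewrite -addn3 addnS [(j + 2)%N]jk -addnn -addnS b_per -addn1 b_per.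
  have Pj1 : positive_word (b 0) (b 1)^-1 (b j.+1)^-1.
    by rewrite -(b_rec_backV j.+1) bj2 bj3.
  by split=> //; rewrite -(b_rec_back j) bj2; exact: positive_word_lmul.
have [|Pj2 Pj3] := IHk j.+2; first by rewrite -jk; lia.
have Pj1 : positive_word (b 0) (b 1)^-1 (b j.+1)^-1.
  by rewrite -(b_rec_backV j.+1); exact: positive_word_mul.
by split=> //; rewrite -(b_rec_back j); exact: positive_word_mul.
Qed.

Lemma periodic_conj_semigroup1 : conj_semigroup (b 0) 1.
Proof.
have [n Syn] : exists n, conj_semigroup (b 0) (b 1 ^- n.+1).
  have [k mk] : exists k, m = k.+3 by exists (m - 3)%N; lia.
  apply: (positive_word_mul_self (forward_positive k) (forward_positive k.+1)).
  by rewrite b_rec -(b_per 1%N) mk addn1.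
have [p Syp] : exists p, conj_semigroup (b 0) ((b 1)^-1 ^- p.+1).
  have [|P2 P3] := @backward_positive 2%N (m - 2)%N; first lia.
  exact: (positive_word_mul_self P2 P3 (b_rec_backV 1%N)).
move: Syp; rewrite expgVn invgK => Syp.
exact: conj_semigroup1_opposite Syp Syn.
Qed.

End PeriodicSequence.

(** * Periodic Fibonacci sequences modulo an integer *)

Section FibonacciModulo.

Import GRing.Theory.
Local Open Scope ring_scope.

Fixpoint fib_from (V : nmodType) (a b : V) (k : nat) : V :=
  if k is k'.+1 then fib_from b (a + b) k' else a.

Lemma fib_from_rec (V : nmodType) (a b : V) k :
  fib_from a b k.+2 = fib_from a b k + fib_from a b k.+1.
Proof. by elim: k a b => [//|k IHk] a b; exact: IHk. Qed.

Definition fib (k : nat) : nat := fib_from 0%N 1%N k.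

Lemma fib_rec k : fib k.+2 = (fib k + fib k.+1)%N.
Proof. exact: fib_from_rec. Qed.

Lemma fib_fromS (V : nmodType) (a b : V) k :
  fib_from a b k.+1 = a *+ fib k + b *+ fib k.+1.
Proof.
elim: k a b => [|k IHk] a b; first by rewrite /= add0r.
by rewrite [LHS]IHk fib_rec mulrnDl mulrnDr addrCA.
Qed.

Lemma fib_from_periodic (V : nmodType) (a b : V) m k :
  fib_from a b m = a -> fib_from a b m.+1 = b ->
  fib_from a b (m + k) = fib_from a b k.
Proof.
move=> wm wm1; suff [] : fib_from a b (m + k) = fib_from a b k /\
  fib_from a b (m + k.+1) = fib_from a b k.+1 by [].
elim: k => [|k [IHk IHk1]]; first by rewrite addn0 addn1.
by split=> //; rewrite !addnS !fib_from_rec -addnS IHk IHk1.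
Qed.

Lemma cassini n :
  (fib n.+1 ^ 2 + odd n = fib n * fib n.+2 + ~~ odd n)%N.
Proof.
elim: n => [//|n IHn]; move: IHn.
rewrite oddS (fib_rec n.+1) (fib_rec n) -!mulnn.
by move: (fib n) (fib n.+1) => p q; case: (odd n) => /=; lia.
Qed.

Lemma fib_gt0 n : (0 < fib n.+1)%N.
Proof.
by elim: n => [//|n IHn]; rewrite fib_rec; exact: ltn_addl.
Qed.

Lemma odd_lt_fib n : (1 < n -> odd n < fib n)%N.
Proof.
case: n => [|[|n]] // _; elim: n => [//|n IHn].
rewrite (fib_rec n.+1) !oddS; move: (fib_gt0 n) IHn; rewrite !oddS; lia.
Qed.

(** Writing A, B for F_n, F_{n+1}, the closed form for w gives
    w_{n+1} = A B + B (1 - A) = w_0 in any ring, and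
    w_{n+2} - w_1 = B^2 + (A + B) (1 - A) - (1 - A), which Cassini's identity
    turns into B + 2 A - 1 + (-1)^n. *)
Lemma fib_from_periodic_mod (R : comNzRingType) n k :
  (fib n.+1)%:R + (fib n)%:R *+ 2 = (odd n)%:R *+ 2 :> R ->
  let w := fib_from (fib n.+1)%:R (1 - (fib n)%:R : R) in
  w (n.+1 + k)%N = w k.
Proof.
move=> N0 w.
have cas : (fib n.+1)%:R ^+ 2 =
    (fib n)%:R * ((fib n)%:R + (fib n.+1)%:R) + 1 - (odd n)%:R *+ 2 :> R.
  have : (fib n.+1 ^ 2 + (odd n).*2 = fib n * (fib n + fib n.+1) + 1)%N.
    by have := cassini n; rewrite fib_rec; case: (odd n) => /=; lia.
  move=> /(congr1 (fun k => k%:R : R)).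
  rewrite !natrD natrX natrM natrD -muln2 natrM mulr_natr => <-.
  by rewrite addrK.
have closed j :
    w j.+1 = (fib n.+1)%:R * (fib j)%:R + (1 - (fib n)%:R) * (fib j.+1)%:R.
  by rewrite /w fib_fromS (mulr_natr (fib n.+1)%:R) (mulr_natr (1 - _)).
apply: fib_from_periodic; rewrite [LHS]closed; first by ring.
by rewrite fib_rec natrD -expr2 cas -N0; ring.
Qed.

Lemma periodic_fib_modulo m : (2 < m)%N ->
  exists N (w : nat -> 'Z_N),
    [/\ forall k, w k + w k.+1 = w k.+2, forall k, w (m + k)%N = w k
       & w 0 != 0].
Proof.
case: m => [//|n]; rewrite ltnS => n_gt1.
have odd_lt := odd_lt_fib n_gt1.
have Fm_gt0 := fib_gt0 n.
(* N = L_m - 1 - (-1)^m for m = n + 1 *)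
pose N := (fib n.+1 + (fib n).*2 - (odd n).*2)%N.
have N_gt1 : (1 < N)%N by rewrite /N; lia.
exists N, (fib_from (fib n.+1)%:R (1 - (fib n)%:R)); split=> [k|k|].
- by rewrite fib_from_rec.
- apply: fib_from_periodic_mod.
  have : (fib n.+1 + (fib n).*2 = N + (odd n).*2)%N by rewrite /N; lia.
  move=> /(congr1 (fun k => k%:R : 'Z_N)).
  by rewrite !natrD pchar_Zp // add0r -!muln2 !natrM !mulr_natr.
apply/eqP => /(congr1 val); rewrite [LHS]val_Zp_nat // modn_small.
  by move=> F0; rewrite F0 in Fm_gt0.
by rewrite /N; lia.
Qed.

End FibonacciModulo.

(** * The Fibonacci groups *)

Lemma iter_ordS m (i : 'I_m) k : iter k (@ordS m) i = (i + k) %% m :> nat.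
Proof.
elim: k => [|k IHk]; first by rewrite addn0 modn_small.
by rewrite /= IHk -addn1 modnDml addn1 addnS.
Qed.

Lemma fib_gen_mul m (i : 'I_m) :
  fib_gen i * fib_gen (ordS i) = fib_gen (ordS (ordS i)).
Proof.
have := @pres_rel _ (@fib_rel m) [:: (i, false); (ordS i, false)]
  [:: (ordS (ordS i), false)].
by rewrite /wval !big_cons !big_nil /= !mulg1; apply; exists i.
Qed.

Lemma fib_gen_neq1 m (i : 'I_m) : (2 < m)%N -> fib_gen i <> 1.
Proof.
move=> m_gt2; have [N [w [w_rec w_per w0]]] := periodic_fib_modulo m_gt2.
have w_mod c k : w (k %% m + c)%N = w (k + c)%N.
  rewrite [in RHS](divn_eq k m) -addnA; elim: (k %/ m) => [//|q IHq].
  by rewrite mulSn -addnA w_per.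
(* The generator a_j goes to w_(j - i), where m - i stands for -i. *)
pose f (j : 'I_m) : 'Z_N := w (j + (m - i))%N.
have [u v [j [-> ->]]|phi [phiM phi_gen]] := @pres_univ _ (@fib_rel m) _ f.
  rewrite /wval !big_cons !big_nil /= !mulg1 /f /= !w_mod.
  by rewrite [in RHS]addSnnS w_mod -addSnnS; exact: w_rec.
have phi1 : phi 1 = 1 by apply: (mulgI (phi 1)); rewrite -phiM !mulg1.
move=> gen1; move: (phi_gen i); rewrite [X in phi X]gen1 phi1 /f.
by rewrite subnKC ?(ltnW (ltn_ord i)) // -[m]addn0 w_per => /esym/eqP /(negP w0).
Qed.

Theorem theorem5p2 (m : nat) (hm : (2 < m)%N) (i : 'I_m) :
  generalized_torsion (fib_gen i).
Proof.
split; first exact: fib_gen_neq1.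
apply: conj_semigroup_prod.
apply: (@periodic_conj_semigroup1 _ (fun k => fib_gen (iter k (@ordS m) i)) m)
  => // k; first exact: fib_gen_mul.
congr fib_gen; apply: ord_inj; rewrite !iter_ordS.
by rewrite addnCA modnDl.
Qed.
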